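(* Let $\mathbb{F}$ be a finite field, let $B$ be a basis of a matroid $N$, and let $M$ be an $\mathbb{F}$-representable $N$-fragile matroid. Then there exists an $\mathbb{F}$-representable $\mathrm{iso}(B,E(N))$-fragile matroid $M'$ such that $E(M')=E(M)$ and $M'/ B=M/ B$.
   Context: A matroid $M$ is $N$-fragile if $N$ is a minor of $M$ (meaning $N$ itself, on the ground set $E(N)\subseteq E(M)$, equals $M/C\setminus D$ for some partition $(C,D)$ of $E(M)-E(N)$; an isomorphic copy does not suffice), but there is no element $e\in E(M)$ such that $N$ is a minor of both $M\setminus e$ and $M/e$. For a finite set $E$ and $B\subseteq E$, $\mathrm{iso}(B,E)$ denotes the matroid on ground set $E$ in which every element of $B$ is a coloop and every element of $E-B$ is a loop (so $B$ is its unique basis). *)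

(* Defs.v *)
From mathcomp Require Import all_boot all_order all_algebra.

Set Implicit Arguments.
Unset Strict Implicit.
Unset Printing Implicit Defensive.

Section Matroids.

Variable T : finType.
Implicit Types (A B C D E I J X : {set T}) (S : {set {set T}}) (e : T).

Definition matroid_axioms E S : bool :=
  [&& set0 \in S,
      [forall I in S, I \subset E],
      [forall I in S, forall (J : {set T} | J \subset I), J \in S]
    & [forall I in S, forall J in S,
        (#|I| < #|J|) ==> [exists e in J :\: I, e |: I \in S]]].

(* The ambient finite type T only serves as a common universe for ground sets:
   a matroid on T may have any E \subset T as its ground set.  The axioms are
   boolean, so Leibniz equality of matroids is equality of ground sets and of
   independent sets (matroid_eqP below). *)
Record matroid := Matroid {
  ground : {set T};
  indeps : {set {set T}};
  _ : matroid_axioms ground indeps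
}.

Implicit Types M N : matroid.

Lemma matroid_eqP M N :
  M = N <-> ground M = ground N /\ indeps M = indeps N.
Proof.
split=> [-> //|]; case: M N => [E S h] [E' S' h'] /= [eE eS].
by subst E' S'; rewrite (bool_irrelevance h h').
Qed.

Lemma matroid_axiomsP E S :
  reflect [/\ set0 \in S,
              forall I, I \in S -> I \subset E,
              forall I J, I \in S -> J \subset I -> J \in S
            & forall I J, I \in S -> J \in S -> #|I| < #|J| ->
                exists2 e, e \in J :\: I & e |: I \in S]
          (matroid_axioms E S).
Proof.
apply: (iffP and4P) => [] [h0 h1 h2 h3]; split=> //.
- exact: (forall_inP h1).
- by move=> I J hI; have /forall_inP := forall_inP h2 I hI; apply.
- move=> I J hI hJ ltIJ.
  have /forall_inP/(_ J hJ) := forall_inP h3 I hI.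
  by rewrite ltIJ => /exists_inP.
- exact/forall_inP.
- by apply/forall_inP=> I hI; apply/forall_inP=> J; apply: h2.
- apply/forall_inP=> I hI; apply/forall_inP=> J hJ.
  by apply/implyP=> ltIJ; apply/exists_inP/h3.
Qed.

Lemma matroidP M : matroid_axioms (ground M) (indeps M).
Proof. by case: M. Qed.

Lemma indep0 M : set0 \in indeps M.
Proof. by have /matroid_axiomsP[] := matroidP M. Qed.

Lemma indep_ground M I : I \in indeps M -> I \subset ground M.
Proof. by have /matroid_axiomsP[_ h _ _] := matroidP M; apply: h. Qed.

Lemma indepS M I J : I \in indeps M -> J \subset I -> J \in indeps M.
Proof. by have /matroid_axiomsP[_ _ h _] := matroidP M; apply: h. Qed.

Lemma indep_augment M I J : I \in indeps M -> J \in indeps M -> #|I| < #|J| ->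
  exists2 e, e \in J :\: I & e |: I \in indeps M.
Proof. by have /matroid_axiomsP[_ _ _ h] := matroidP M; apply: h. Qed.

Definition basis_of M X B : bool :=
  maxset [pred I : {set T} | (I \subset X) && (I \in indeps M)] B.

Definition basis M B : bool := maxset [pred I | I \in indeps M] B.

Lemma basis_of_exists M X : exists B, basis_of M X B.
Proof.
have h : [pred I : {set T} | (I \subset X) && (I \in indeps M)] set0.
  by rewrite /= sub0set indep0.
by have [B hB _] := maxset_exists h; exists B.
Qed.

Lemma basis_of_sub M X B : basis_of M X B -> B \subset X.
Proof. by move/maxsetp=> /andP[]. Qed.

Lemma basis_of_indep M X B : basis_of M X B -> B \in indeps M.
Proof. by move/maxsetp=> /andP[]. Qed.

Lemma basis_of_max M X B e :
  basis_of M X B -> e \in X -> e |: B \in indeps M -> e \in B.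
Proof.
move=> hB eX hi; suff <- : e |: B = B by rewrite setU11.
apply: (maxsetsup hB); last exact: subsetUr.
by rewrite /= hi subUset sub1set eX (basis_of_sub hB).
Qed.

Lemma leq_card_basis_of M X B I :
  basis_of M X B -> I \subset X -> I \in indeps M -> #|I| <= #|B|.
Proof.
move=> hB sIX hI; rewrite leqNgt; apply/negP=> lt.
have [e] := indep_augment (basis_of_indep hB) hI lt.
rewrite inE => /andP[/negP eB eI] hi; apply: eB.
exact: basis_of_max hB (subsetP sIX _ eI) hi.
Qed.

Lemma delete_subproof M D :
  matroid_axioms (ground M :\: D) [set I in indeps M | [disjoint I & D]].
Proof.
apply/matroid_axiomsP; split.
- by rewrite inE indep0 disjoints_subset sub0set.
- by move=> I; rewrite inE subsetD => /andP[/indep_ground -> ->].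
- move=> I J; rewrite !inE => /andP[hI dI] sJI.
  by rewrite (indepS hI sJI) (disjointWl sJI dI).
- move=> I J; rewrite !inE => /andP[hI dI] /andP[hJ dJ] lt.
  have [e eJI hi] := indep_augment hI hJ lt; exists e => //.
  rewrite inE hi disjoints_subset subUset -!disjoints_subset dI andbT disjoints1.
  apply/negP=> eD.
  by move: eJI; rewrite inE => /andP[_ /(disjointFr dJ)]; rewrite eD.
Qed.

Definition delete M D : matroid := Matroid (delete_subproof M D).

Definition contract_indeps M C : {set {set T}} :=
  [set I : {set T} | [disjoint I & C] &&
     [exists J, basis_of M C J && (I :|: J \in indeps M)]].

Lemma contract_subproof M C :
  matroid_axioms (ground M :\: C) (contract_indeps M C).
Proof.
apply/matroid_axiomsP; split.
- rewrite inE disjoints_subset sub0set /=.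
  have [J hJ] := basis_of_exists M C; apply/existsP; exists J.
  by rewrite hJ set0U (basis_of_indep hJ).
- move=> I; rewrite inE subsetD => /andP[-> /existsP[J /andP[_ /indep_ground]]].
  by rewrite subUset => /andP[->].
- move=> I J; rewrite !inE => /andP[dI /existsP[K /andP[hK hi]]] sJI.
  rewrite (disjointWl sJI dI); apply/existsP; exists K.
  by rewrite hK (indepS hi) // setSU.
- move=> I1 I2; rewrite !inE => /andP[d1 /existsP[J1 /andP[b1 i1]]].
  move=> /andP[d2 /existsP[J2 /andP[b2 i2]]] lt.
  have card_dis I J : [disjoint I & C] -> basis_of M C J ->
      #|I :|: J| = #|I| + #|J|.
    move=> dI bJ; apply/eqP; rewrite (leq_card_setU I J).2.
    exact: disjointWr (basis_of_sub bJ) dI.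
  have [|e] := indep_augment i1 i2.
    rewrite !card_dis // -addSn leq_add //.
    exact: leq_card_basis_of b2 (basis_of_sub b1) (basis_of_indep b1).
  rewrite !inE negb_or => /andP[/andP[e1 eJ1] /orP e2] hi.
  have eC : e \notin C.
    apply/negP=> eC; move/negP: eJ1; apply; apply: basis_of_max b1 eC _.
    by apply: indepS hi _; rewrite setUS // subsetUr.
  have eI2 : e \in I2.
    by case: e2 => // /(subsetP (basis_of_sub b2)); rewrite (negPf eC).
  exists e; first by rewrite inE e1.
  rewrite inE disjoints_subset subUset -!disjoints_subset disjoints1 eC d1 /=.
  by apply/existsP; exists J1; rewrite b1 -setUA.
Qed.

(* I is independent in M / C iff I :|: J is independent in M for a basis J of
   the restriction of M to C; the choice of J is immaterial. *)
Definition contract M C : matroid := Matroid (contract_subproof M C).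

Definition minor N M : Prop :=
  ground N \subset ground M /\
  exists C D, [/\ C :|: D = ground M :\: ground N, [disjoint C & D]
                & N = delete (contract M C) D].

Definition fragile N M : Prop :=
  minor N M /\
  ~ (exists e, [/\ e \in ground M,
                   minor N (delete M [set e]) & minor N (contract M [set e])]).

Lemma iso_subproof B E : matroid_axioms E (powerset (B :&: E)).
Proof.
apply/matroid_axiomsP; split.
- by rewrite inE sub0set.
- by move=> I; rewrite inE subsetI => /andP[].
- by move=> I J; rewrite !inE => hI /subset_trans; apply.
- move=> I J; rewrite !inE => hI hJ lt.
  have /subsetPn[e eJ eI] : ~~ (J \subset I).
    by apply/negP=> /subset_leq_card; rewrite leqNgt lt.
  by exists e; rewrite inE ?eI // subUset sub1set (subsetP hJ _ eJ).
Qed.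

(* Meant for B \subset E; see basis_iso, loop_iso and coloop_iso. *)
Definition iso B E : matroid := Matroid (iso_subproof B E).

Definition loop M e : Prop := e \in ground M /\ [set e] \notin indeps M.

Definition coloop M e : Prop :=
  e \in ground M /\ forall B, basis M B -> e \in B.

Lemma basis_iso B E X : B \subset E -> basis (iso B E) X = (X == B).
Proof.
move=> /setIidPl sBE; apply/idP/eqP => [hX|->].
  apply/esym/(maxsetsup hX); first by rewrite /= sBE inE.
  by have := maxsetp hX; rewrite /= sBE inE.
apply/maxsetP; split=> [|A]; first by rewrite /= sBE inE.
by rewrite /= sBE inE => sAB sBA; apply/eqP; rewrite eqEsubset sAB.
Qed.

Lemma loop_iso B E e : B \subset E -> loop (iso B E) e <-> e \in E :\: B.
Proof.
move=> /setIidPl sBE; rewrite /loop /= sBE !inE sub1set.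
by split=> [[-> ->] | /andP[]].
Qed.

Lemma coloop_iso B E e : B \subset E -> coloop (iso B E) e <-> e \in B.
Proof.
move=> sBE; split=> [[_ /(_ B)]|eB]; first by rewrite basis_iso // eqxx; apply.
split=> [|X]; first exact: (subsetP sBE).
by rewrite basis_iso // => /eqP ->.
Qed.

(* Linear independence is tested on the family (v x)_(x in I), so two parallel
   elements carrying equal vectors are dependent; the values of v outside the
   ground set are irrelevant. *)
Definition representable (F : fieldType) M : Prop :=
  exists (n : nat) (v : T -> 'cV[F]_n), forall I, I \subset ground M ->
    (I \in indeps M) = free [seq v x | x <- enum I].

End Matroids.

(* Main.v *)
Require Import Defs.
From mathcomp Require Import all_boot all_order all_algebra.

(** Let [v] represent [M] and let [C] be the contracted set of an [N]-minor, so
    that the vectors of [E(N)] lie in the direct sum of [U = <v B>] and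
    [W = <v C>].  Replace the vectors of [E(N) - B] by their projections onto
    [W] along [U], which leaves [M / B] unchanged, and let [M'] be the resulting
    matroid.  If [M' / C' \ D' = iso(B, E(N))], then modulo [<v C'>] the new
    vectors of [E(N) - B] vanish, so there the old vectors of [E(N)] agree with
    their projections onto [U], and [U] is embedded; the same is true modulo
    [W], hence [M / C' \ D' = N].  So every pair of partitions violating the
    fragility of [M'] violates that of [M]. *)

Set Implicit Arguments.
Unset Strict Implicit.
Unset Printing Implicit Defensive.

Import GRing.Theory.

(** * Freeness and spans of vector families, and their behaviour under quotients *)

Section VectorFamilies.

Local Open Scope ring_scope.

Variables (F : fieldType) (T : finType) (vT : vectType F).
Implicit Types (v w : T -> vT) (I J C : {set T}) (f g : 'End(vT)).

Definition vfree v I := free [seq v x | x <- enum I].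
Definition vspan v I := <<[seq v x | x <- enum I]>>%VS.

Lemma eq_in_vmap v w I : {in I, v =1 w} ->
  [seq v x | x <- enum I] = [seq w x | x <- enum I].
Proof. by move=> e; apply/eq_in_map=> x; rewrite mem_enum; apply: e. Qed.

Lemma eq_in_vfree v w I : {in I, v =1 w} -> vfree v I = vfree w I.
Proof. by move=> e; rewrite /vfree (eq_in_vmap e). Qed.

Lemma eq_in_vspan v w I : {in I, v =1 w} -> vspan v I = vspan w I.
Proof. by move=> e; rewrite /vspan (eq_in_vmap e). Qed.

Lemma mem_vspan v I x : x \in I -> v x \in vspan v I.
Proof. by move=> xI; apply/memv_span/map_f; rewrite mem_enum. Qed.

Lemma vspan_subP v I (U : {vspace vT}) :
  reflect (forall x, x \in I -> v x \in U) (vspan v I <= U)%VS.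
Proof.
apply: (iffP span_subvP) => h x; first by move=> xI; apply/h/map_f; rewrite mem_enum.
by case/mapP=> y; rewrite mem_enum => yI ->; apply: h.
Qed.

Lemma vspanS v I J : I \subset J -> (vspan v I <= vspan v J)%VS.
Proof. by move=> /subsetP s; apply/vspan_subP=> x /s; apply: mem_vspan. Qed.

Lemma vspanU v I J : vspan v (I :|: J) = (vspan v I + vspan v J)%VS.
Proof.
apply/eqP; rewrite eqEsubv; apply/andP; split; last first.
  by rewrite subv_add (vspanS v (subsetUl I J)) (vspanS v (subsetUr I J)).
apply/vspan_subP=> x; case/setUP=> /(mem_vspan v); move: (v x).
  exact/subvP/addvSl.
exact/subvP/addvSr.
Qed.

Lemma vspan_comp f v I : vspan (f \o v) I = (f @: vspan v I)%VS.
Proof. by rewrite /vspan limg_span -map_comp. Qed.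

Lemma perm_enumU I J : [disjoint I & J] ->
  perm_eq (enum (I :|: J)) (enum I ++ enum J).
Proof.
move=> dIJ; apply: uniq_perm => [||x]; first exact: enum_uniq.
  rewrite cat_uniq !enum_uniq /= andbT; apply/hasPn=> x; rewrite !mem_enum => xJ.
  by rewrite (disjointFl dIJ xJ).
by rewrite mem_cat !mem_enum inE.
Qed.

Lemma vfreeU v I J : [disjoint I & J] ->
  vfree v (I :|: J) = [&& vfree v I, vfree v J & (vspan v I :&: vspan v J == 0)%VS].
Proof.
move=> dIJ; rewrite /vfree (perm_free (perm_map v (perm_enumU dIJ))).
by rewrite map_cat cat_free (sameP eqP directv_addP).
Qed.

Lemma vfree1 v x : vfree v [set x] = (v x != 0).
Proof. by rewrite /vfree enum_set1 seq1_free. Qed.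

Lemma vfreeU1 v x I : x \notin I ->
  vfree v (x |: I) = (v x \notin vspan v I) && vfree v I.
Proof.
move=> xI; rewrite /vfree (perm_free (perm_map v (perm_enumU _))) ?disjoints1 //.
by rewrite enum_set1 /= free_cons.
Qed.

Lemma vfreeS v I J : J \subset I -> vfree v I -> vfree v J.
Proof.
move=> sJI; rewrite -(setID I J) (setIidPr sJI) vfreeU; first by case/and3P.
by rewrite disjoints_subset; apply/subsetP=> x xJ; rewrite !inE xJ.
Qed.

Lemma dim_vspan v I : vfree v I -> \dim (vspan v I) = #|I|.
Proof. by rewrite /vfree /free => /eqP ->; rewrite size_map -cardE. Qed.

(** By rank-nullity, the dimension of the image is [\dim (vspan v I)] minus that of the intersection
    with the kernel, and [\dim (vspan v I)] is at most [#|I|]. So the image has dimension [#|I|]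
    exactly when nothing is lost at either stage. *)
Lemma vfree_comp f v I :
  vfree (f \o v) I = vfree v I && (vspan v I :&: lker f == 0)%VS.
Proof.
rewrite /vfree /free -/(vspan _ _) -/(vspan _ _) vspan_comp !size_map.
have le : (\dim (vspan v I) <= size (enum I))%N.
  by rewrite -(size_map v); apply: dim_span.
rewrite -dimv_eq0; have := limg_ker_dim f (vspan v I).
set a := \dim (_ :&: _)%VS; set b := \dim (f @: _)%VS => e.
rewrite -e in le *; apply/eqP/andP => [eb|[/eqP eab /eqP a0]]; last first.
  by rewrite -eab a0 add0n.
have a0 : a = 0%N.
  by apply/eqP; rewrite -leqn0 -(leq_add2r b) add0n (leq_trans le) ?eb.
by rewrite a0 add0n eb eqxx.
Qed.

(** Freeness sees a linear map only through its kernel, so different endomorphisms may stand for the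
    same quotient map. *)
Lemma eq_lker_vfree f g v I : lker f = lker g ->
  vfree (f \o v) I = vfree (g \o v) I.
Proof. by move=> e; rewrite !vfree_comp e. Qed.

(* The endomorphism of [vT] that stands for the quotient map by [W]. *)
Definition quotv (W : {vspace vT}) : 'End(vT) := (\1 - projv W)%VF.

Lemma lker_quotv W : lker (quotv W) = W.
Proof.
apply/vspaceP=> x; rewrite memv_ker !lfunE /= !lfunE /= subr_eq0.
by apply/eqP/idP => [->|/projv_id //]; apply: memv_proj.
Qed.

Lemma quotv_eq W x y : (quotv W x == quotv W y) = (x - y \in W).
Proof. by rewrite -subr_eq0 -linearB -memv_ker lker_quotv. Qed.

(** A form of the third isomorphism theorem; it merges two successive contractions into one. *)
Lemma lker_comp_quotv f (W : {vspace vT}) :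
  lker (quotv (f @: W) \o f)%VF = (W + lker f)%VS.
Proof.
apply/vspaceP=> x; rewrite memv_ker comp_lfunE -memv_ker lker_quotv.
apply/memv_imgP/memv_addP => [[u uW e]|[u uW [z zf ->]]].
  exists u => //; exists (x - u); last by rewrite addrC subrK.
  by rewrite memv_ker linearB /= e subrr.
by exists u => //; rewrite linearD /= (eqP (_ : f z == 0)) ?addr0 // -memv_ker.
Qed.

End VectorFamilies.

(** * Matroids represented by vector families, their minors, and the modified family *)

Section LinearMatroids.

Local Open Scope ring_scope.

Variables (F : fieldType) (T : finType) (vT : vectType F).
Implicit Types (v w : T -> vT) (I J B C D E : {set T}) (M N : matroid T).

Definition represents v M :=
  forall I, I \subset ground M -> (I \in indeps M) = vfree v I.

Lemma represents_inj v M N :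
  ground M = ground N -> represents v M -> represents v N -> M = N.
Proof.
move=> eE hM hN; apply/matroid_eqP; split=> //; apply/setP=> I.
have [sI|nsI] := boolP (I \subset ground M); first by rewrite hM // hN -?eE.
by apply/idP/idP => /indep_ground; rewrite -?eE (negPf nsI).
Qed.

Lemma eq_in_represents v w M :
  {in ground M, v =1 w} -> represents v M -> represents w M.
Proof.
move=> e hM I sI; rewrite hM //; apply: eq_in_vfree => x /(subsetP sI).
exact: e.
Qed.

Lemma linear_matroid_subproof v E :
  matroid_axioms E [set I : {set T} | (I \subset E) && vfree v I].
Proof.
apply/matroid_axiomsP; split.
- by rewrite inE sub0set /vfree enum_set0 nil_free.
- by move=> I; rewrite inE => /andP[].
- move=> I J; rewrite !inE => /andP[sI fI] sJI.
  by rewrite (subset_trans sJI sI) (vfreeS sJI fI).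
move=> I J; rewrite !inE => /andP[sI fI] /andP[sJ fJ] lt.
(* Otherwise [vspan v J] would lie in [vspan v I], and comparing dimensions would give
   [#|J| <= #|I|]. *)
have /exists_inP[x xJ xI] : [exists x in J, v x \notin vspan v I].
  apply: contraTT lt => /exists_inPn h; rewrite -leqNgt -(dim_vspan fI).
  rewrite -(dim_vspan fJ); apply/dimvS/vspan_subP=> x /h.
  by rewrite negbK.
have xnI : x \notin I by apply: contra xI; apply: mem_vspan.
exists x; first by rewrite inE xnI.
by rewrite inE subUset sub1set (subsetP sJ _ xJ) sI vfreeU1 // xI.
Qed.

Definition linear_matroid v E : matroid T := Matroid (linear_matroid_subproof v E).

Lemma linear_matroid_represents v E : represents v (linear_matroid v E).
Proof. by move=> I sI; rewrite inE sI. Qed.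

Lemma represents_delete v M D : represents v M -> represents v (delete M D).
Proof.
by move=> hM I; rewrite /= subsetD inE => /andP[sI ->]; rewrite andbT hM.
Qed.

(** An element of [C] whose vector lay outside [vspan v J] could be added to [J], against
    maximality. *)
Lemma vspan_basis_of v M C J : represents v M -> C \subset ground M ->
  Defs.basis_of M C J -> vspan v J = vspan v C.
Proof.
move=> hM sC bJ; have sJ := basis_of_sub bJ.
apply/eqP; rewrite eqEsubv vspanS //=; apply/vspan_subP=> x xC.
have [xJ|xJ] := boolP (x \in J); first exact: mem_vspan.
apply: contraNT xJ => nx; apply: (basis_of_max bJ) => //.
have sJM := subset_trans sJ sC.
rewrite hM ?subUset ?sub1set ?(subsetP sC) //.
rewrite vfreeU1; last by apply: contra nx; apply: mem_vspan.
by rewrite nx -hM // (basis_of_indep bJ).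
Qed.

Lemma represents_contract v M C : represents v M -> C \subset ground M ->
  represents (quotv (vspan v C) \o v) (contract M C).
Proof.
move=> hM sC I; rewrite /= subsetD inE => /andP[sI dI]; rewrite dI /=.
(* All bases [J] of [C] have the same span, so the test is freeness modulo one fixed subspace,
   whichever [J] is chosen. *)
have key J : Defs.basis_of M C J ->
    (I :|: J \in indeps M) = vfree (quotv (vspan v C) \o v) I.
  move=> bJ; have sJ := basis_of_sub bJ; have sJM := subset_trans sJ sC.
  rewrite hM ?subUset ?sI // vfreeU; last exact: disjointWr dI.
  rewrite -(hM J) // (basis_of_indep bJ) (vspan_basis_of hM sC bJ).
  by rewrite vfree_comp lker_quotv.
apply/existsP/idP => [[J /andP[bJ]]|fI]; first by rewrite key.
by have [J bJ] := basis_of_exists M C; exists J; rewrite bJ key.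
Qed.

(** Deletion does not change the vectors, and the deleted set is the rest of
    [ground M :\: ground N], so the contracted set alone records the minor. *)
Lemma minorP v M N : represents v M ->
  minor N M <-> ground N \subset ground M /\
    exists2 C : {set T}, C \subset ground M :\: ground N &
               represents (quotv (vspan v C) \o v) N.
Proof.
move=> hM; split=> [[sN [C [D [eCD dCD eN]]]]|[sN [C sC hN]]].
  have sC : C \subset ground M :\: ground N by rewrite -eCD subsetUl.
  split=> //; exists C => //; rewrite eN.
  apply/represents_delete/represents_contract => //.
  exact: subset_trans sC (subsetDl _ _).
split=> //; exists C, ((ground M :\: ground N) :\: C); split.
- by rewrite -{1}(setIidPr sC) setID.
- by rewrite disjoint_sym disjoints_subset subsetDr.
apply: represents_inj hN _ => /=; last first.
  apply/represents_delete/represents_contract => //.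
  exact: subset_trans sC (subsetDl _ _).
apply/setP=> x; rewrite !inE.
have := subsetP sC x; have := subsetP sN x; rewrite !inE.
by case: (x \in ground N); case: (x \in C); case: (x \in ground M) => //= h1 h2;
  rewrite ?(h1 isT) //; have := h2 isT.
Qed.

(** With [minor_contractP], fragility becomes a condition on contracted sets: for no [e] outside
    [ground N] can one set producing [N] avoid [e] and another contain it. *)
Lemma minor_deleteP v M N e : represents v M -> e \in ground M ->
  minor N (delete M [set e]) <-> ground N \subset ground M :\ e /\
    exists2 C : {set T}, (C \subset ground M :\: ground N) && (e \notin C) &
               represents (quotv (vspan v C) \o v) N.
Proof.
move=> hM eM; apply: (iff_trans (minorP N (represents_delete hM))) => /=.
have eqs C : (C \subset ground M :\ e :\: ground N) =
             (C \subset ground M :\: ground N) && (e \notin C).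
  by rewrite setDDl setUC -setDDl subsetD1.
by split=> [[sN [C sC hC]]|[sN [C sC hC]]]; split=> //; exists C => //;
  rewrite ?eqs // -eqs.
Qed.

Lemma minor_contractP v M N e : represents v M -> e \in ground M ->
  minor N (contract M [set e]) <-> ground N \subset ground M :\ e /\
    exists2 C : {set T}, (C \subset ground M :\: ground N) && (e \in C) &
               represents (quotv (vspan v C) \o v) N.
Proof.
move=> hM eM; have sM : [set e] \subset ground M by rewrite sub1set.
apply: (iff_trans (minorP N (represents_contract hM sM))) => /=.
set f := quotv (vspan v [set e]).
(* The quotient by [v e] followed by the quotient by the image of [vspan v C] has kernel
   [vspan v (e |: C)]. *)
have key C I : vfree (quotv (vspan (f \o v) C) \o (f \o v)) I =
               vfree (quotv (vspan v (e |: C)) \o v) I.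
  transitivity (vfree ((quotv (f @: vspan v C) \o f)%VF \o v) I).
    by rewrite vspan_comp; apply: eq_in_vfree => x _; rewrite /= comp_lfunE.
  by apply: eq_lker_vfree; rewrite lker_comp_quotv !lker_quotv vspanU addvC.
split=> [[sN [C sC hC]]|[sN [C /andP[sC eC] hC]]]; split=> //.
  exists (e |: C); last by move=> I sI; rewrite -key hC.
  have eN : e \notin ground N.
    by apply/negP=> /(subsetP sN); rewrite !inE eqxx.
  rewrite setU11 andbT subUset sub1set inE eN eM /=.
  by apply: subset_trans sC _; rewrite setSD // subsetDl.
exists (C :\ e); last by move=> I sI; rewrite key setD1K // hC.
by rewrite setDDl setUC -setDDl setSD.
Qed.

(** Freeness of [f \o v] on [B] makes [f] injective on [vspan v B], which contains every [w x] with
    [x] in [I]; hence [f] preserves and reflects freeness of [w] on [I]. *)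
Lemma vfree_comp_eq (f : 'End(vT)) v w B I :
  vfree (f \o v) B -> {in I, forall x, w x \in vspan v B} ->
  {in I, f \o v =1 f \o w} -> vfree (f \o v) I = vfree w I.
Proof.
rewrite vfree_comp => /andP[_ /eqP cap0] wB e.
rewrite (eq_in_vfree e) vfree_comp; suff -> : (vspan w I :&: lker f = 0)%VS.
  by rewrite eqxx andbT.
by apply/eqP; rewrite -subv0 -cap0 capvS //; apply/vspan_subP.
Qed.

Lemma fragile_iso_family v N M B : represents v M -> basis N B -> fragile N M ->
  exists w, fragile (iso B (ground N)) (linear_matroid w (ground M)) /\
            contract (linear_matroid w (ground M)) B = contract M B.
Proof.
move=> hv hB hfrag.
have [hmin hno] := hfrag; have [sNM [C sC hN]] := (minorP N hv).1 hmin.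
have iB : B \in indeps N := maxsetp hB; have sBN := indep_ground iB.
have fB : vfree (quotv (vspan v C) \o v) B by rewrite -hN.
pose U := vspan v B; pose W := vspan v C.
have cap0 : (U :&: W = 0)%VS.
  by move: fB; rewrite vfree_comp lker_quotv => /andP[_ /eqP].
(* For [x] outside [B], maximality of [B] makes [x |: B] dependent in [N], so [v x] is congruent
   modulo [W] to a vector of [U]. *)
have vUW x : x \in ground N -> v x \in (U + W)%VS.
  move=> xN; have [xB|xB] := boolP (x \in B).
    exact: (subvP (addvSl _ _) _ (mem_vspan v xB)).
  have : x |: B \notin indeps N.
    apply: contra xB => xBi.
    by rewrite -(maxsetsup hB xBi (subsetUr _ _)) setU11.
  rewrite hN ?subUset ?sub1set ?xN // vfreeU1 // fB andbT negbK vspan_comp.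
  case/memv_imgP=> u uU /eqP; rewrite /= quotv_eq => xuW.
  by rewrite -(subrK u (v x)) addrC memv_add.
(* [p] projects onto [U] along [W], and [q] onto [W] along [U]; they add up to the identity on
   [U + W], whence the need for [vUW]. *)
pose p := daddv_pi U W; pose q := daddv_pi W U.
have pq x : x \in ground N -> (v x - p (v x) = q (v x))%R.
  by move=> xN; rewrite -{1}(daddv_pi_add cap0 (vUW x xN)) addrC addKr.
have pB x : x \in B -> p (v x) = v x.
  by move=> xB; apply: daddv_pi_id => //; apply: mem_vspan.
pose w x := if x \in ground N :\: B then q (v x) else v x.
have w_out x : x \notin ground N :\: B -> w x = v x by rewrite /w => /negPf ->.
have w_in x : x \in ground N -> x \notin B -> w x = q (v x).
  by move=> xN xB; rewrite /w inE xN xB.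
have wB : {in B, w =1 v} by move=> x xB; apply: w_out; rewrite inE xB.
have spanC (C' : {set T}) : C' \subset ground M :\: ground N -> vspan w C' = vspan v C'.
  move=> /subsetP sC'; apply: eq_in_vspan => x /sC'; rewrite inE => /andP[xN _].
  by apply: w_out; rewrite inE negb_and xN orbT.
(* Modulo [W], [v x] agrees with [p (v x)]. So [p \o v] represents [N] without reference to [C], and
   can be compared with any other contracted set. *)
have NE (I : {set T}) : I \subset ground N -> (I \in indeps N) = vfree (p \o v) I.
  move=> /subsetP sI; rewrite hN; last exact/subsetP.
  apply: vfree_comp_eq fB _ _ => x /sI xN; first exact: memv_pi.
  by apply/eqP; rewrite /= quotv_eq pq // memv_pi.
pose M' := linear_matroid w (ground M).
have hw : represents w M' by apply: linear_matroid_represents.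
have sB : B \subset B :&: ground N by rewrite subsetI subxx.
have transfer (C' : {set T}) : C' \subset ground M :\: ground N ->
    represents (quotv (vspan w C') \o w) (iso B (ground N)) ->
    represents (quotv (vspan v C') \o v) N.
  move=> sC' hiso I /subsetP sI; rewrite NE; last exact/subsetP.
  have fB' : vfree (quotv (vspan v C') \o v) B.
    rewrite -(spanC C' sC').
    rewrite -(eq_in_vfree (v := quotv (vspan w C') \o w)).
      by rewrite -hiso // inE.
    by move=> x xB /=; rewrite wB.
  apply/esym/(vfree_comp_eq fB') => x /sI xN; first exact: memv_pi.
  (* It remains to put [q (v x)] in [vspan v C']. It is zero for [x] in [B]; otherwise it is [w x],
     which vanishes modulo [vspan w C'] because [x] is a loop of [iso B (ground N)]. *)
  apply/eqP; rewrite /= quotv_eq pq //.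
  have [xB|xB] := boolP (x \in B); first by rewrite -pq // pB // subrr mem0v.
  rewrite -w_in // -(spanC C' sC') -[vspan w C']lker_quotv memv_ker.
  have := hiso [set x]; rewrite vfree1 /= sub1set xN inE sub1set inE (negPf xB).
  by move=> /(_ isT)/esym/negbFE.
exists w; split.
  split.
    (* The same [C] works: modulo [W] the vectors of [B] stay free, while those of [ground N :\: B]
       now lie in [W] and become zero. *)
    apply/(minorP _ hw); split=> //; exists C => // I /= sI; rewrite inE.
    rewrite subsetI sI andbT spanC //; apply/idP/idP => [sIB|fI].
      rewrite (eq_in_vfree (w := quotv W \o v)) ?(vfreeS sIB) //.
      by move=> x /(subsetP sIB) xB /=; rewrite wB.
    apply/subsetP=> x xI; apply: contraTT fI => xB.
    apply: (contra (vfreeS (J := [set x]) _)); first by rewrite sub1set.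
    rewrite vfree1 negbK /= -memv_ker lker_quotv w_in ?memv_pi //.
    exact: (subsetP sI).
  case=> e [eM /(minor_deleteP _ hw eM)[sN1 [C1 /andP[sC1 eC1] h1]]].
  move=> /(minor_contractP _ hw eM)[_ [C2 /andP[sC2 eC2] h2]].
  apply: hno; exists e; split=> //.
    apply/(minor_deleteP _ hv eM); split=> //; exists C1; rewrite ?sC1 //.
    exact: transfer.
  apply/(minor_contractP _ hv eM); split=> //; exists C2; rewrite ?sC2 //.
  exact: transfer.
have sBM := subset_trans sBN sNM.
apply: (represents_inj (v := quotv U \o v)) => //; last exact: represents_contract.
apply: eq_in_represents (represents_contract hw sBM) => x _.
(* Both contractions are quotients by [U], and a modified vector differs from the old one by
   [p (v x)], which lies in [U]. *)
rewrite (eq_in_vspan wB) /=; apply/eqP; rewrite quotv_eq.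
have [|/w_out->] := boolP (x \in ground N :\: B); last by rewrite subrr mem0v.
rewrite inE => /andP[xB xN]; rewrite w_in // -pq // addrAC subrr add0r rpredN.
exact: memv_pi.
Qed.

End LinearMatroids.

Theorem theorem1p4 (F : finFieldType) (T : finType) (N M : matroid T)
    (B : {set T}) (hB : basis N B) (hM : representable F M)
    (hfrag : fragile N M) :
  exists M' : matroid T,
    [/\ representable F M', fragile (iso B (ground N)) M',
        ground M' = ground M & contract M' B = contract M B].
Proof.
case: hM => n [v hv]; have [w [hfr hct]] := fragile_iso_family hv hB hfrag.
exists (linear_matroid w (ground M)); split=> //.
by exists n, w; apply: linear_matroid_represents.
Qed.
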